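(* Let $f:\mathbb{R}^n\to\mathbb{R}$ be a continuous selection of $\mathcal{C}^1$-functions $f_i:\mathbb{R}^n\to\mathbb{R}$, $i\in I=\{1,\dots,m\}$, whose gradients $\nabla f_i$ are locally Lipschitz continuous. Assume that $f$ has a critical point $x^*\in\mathbb{R}^n$ such that: (i) there is $\alpha\in\mathbb{R}^m$ with $\alpha_i>0$ for all $i\in I$ and $\sum_{i=1}^m\alpha_i\nabla f_i(x^* )=0$; (ii) the vectors $\nabla f_i(x^* )$, $i\in I$, are affinely independent; (iii) $x^*$ is the unique global minimum of $f$, and there is some $z\in\mathbb{R}^n\setminus\{x^*\}$ such that $\{x\in\mathbb{R}^n: f(x)\le f(z)\}$ is bounded. Let $(x^{l,0})_l\subseteq\mathbb{R}^n$ be a sequence of initial points for the quasi-Newton method with $\lim_{l\to\infty}x^{l,0}=x^*$. For $l\in\mathbb{N}$ let $(x^{l,k})_k$, $(H_{l,k})_k$, $(y^{l,k})_k$ denote the sequences $(x^k)_k$, $(H_k)_k$, $(y^k)_k$ generated by the quasi-Newton method applied to $f$ with initial point $x^{l,0}$, and let $\lambda_1^{l,k}\le\dots\le\lambda_n^{l,k}$ be the eigenvalues of $H_{l,k}$. Assume that there are $\sigma_L,\sigma_U>0$ such that for each $l\in\mathbb{N}$ the method, with parameters $c_1,c_2$ that are fixed (independent of $l$), does not stop in the first $m-1$ iterations, and that 1. $\lambda_j^{l,k}\in[\sigma_L,\sigma_U]$ for all $l\in\mathbb{N}$, $k\in\{0,\dots,m-2\}$, $j\in\{k+1,\dots,n\}$;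 2. $\lim_{l\to\infty}H_{l,k'}\,y^{l,k}=0$ for all $k'\in\{1,\dots,m-2\}$, $k\in\{0,\dots,k'-1\}$. Then there is some $N>0$ such that for all $l>N$, $$\bigcup_{k=0}^{m-1}I_g(x^{l,k})=I=\{1,\dots,m\}.$$
   Context: Continuous selection: $f:\mathbb{R}^n\to\mathbb{R}$ is a continuous selection of $f_i$, $i\in I=\{1,\dots,m\}$, $m\in\mathbb{N}$, if $f$ is continuous and $f(x)\in\{f_i(x): i\in I\}$ for all $x\in\mathbb{R}^n$. $\Omega$ denotes the set of points at which $f$ is not differentiable. The essentially active set is $I_e(x)=\{i\in I: x\in\mathrm{cl}(\mathrm{int}(\{y\in\mathbb{R}^n: f(y)=f_i(y)\}))\}$. For $x\notin\Omega$, $I_g(x)=\{i\in I_e(x):\nabla f(x)=\nabla f_i(x)\}$. Critical point: $x$ is critical if $0\in\partial f(x)$, where $\partial f$ is the Clarke subdifferential; for continuous selections of $\mathcal{C}^1$-functions, $\partial f(x)=\mathrm{conv}(\{\nabla f_i(x): i\in I_e(x)\})$. Wolfe conditions: for $x\notin\Omega$, $p\in\mathbb{R}^n$ with $\nabla f(x)^\top p<0$, and $c_1,c_2\in(0,1)$ with $c_1<c_2$, a step length $t>0$ satisfies the Wolfe conditions if $x+tp\notin\Omega$, $f(x+tp)\le f(x)+c_1t\nabla f(x)^\top p$, and $\nabla f(x+tp)^\top p\ge c_2\nabla f(x)^\top p$. Quasi-Newton method: Given an initial point $x^0\in\mathbb{R}^n\setminus\Omega$, an initial symmetric positive definite matrix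 $H_0\in\mathbb{R}^{n\times n}$, and $c_1,c_2\in(0,1)$ with $c_1<c_2$, for $k=0,1,\dots$: if $\nabla f(x^k)=0$ stop; set $p^k=-H_k\nabla f(x^k)$; set $x^{k+1}=x^k+t_kp^k$ where $t_k>0$ satisfies the Wolfe conditions (at $x^k$ with direction $p^k$); if $f$ is not differentiable at $x^{k+1}$ stop (the method ''breaks down''); for $y^k=\nabla f(x^{k+1})-\nabla f(x^k)$ and $s^k=x^{k+1}-x^k$, choose any symmetric positive definite matrix $H_{k+1}\in\mathbb{R}^{n\times n}$ with $H_{k+1}y^k=s^k$. (No particular choice of $t_k$ or update formula for $H_{k+1}$ is prescribed.) The first $m-1$ iterations are those with $k=0,\dots,m-2$; index ranges such as $\{0,\dots,m-2\}$ are empty when the upper bound is smaller than the lower bound. *)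

(* Defs.v *)
From HB Require Import structures.
From mathcomp Require Import all_boot all_order all_algebra.
From mathcomp Require Import all_classical all_reals all_analysis.

Set Implicit Arguments.
Unset Strict Implicit.
Unset Printing Implicit Defensive.

Import Order.TTheory GRing.Theory Num.Theory.
Import numFieldNormedType.Exports.

Local Open Scope classical_set_scope.
Local Open Scope ring_scope.

(* Vectors of R^n are columns 'cV[R]_n.  They carry the library's max-norm; the
   topology, boundedness and local Lipschitz continuity do not depend on this
   choice of norm. *)

Definition dotv (R : realType) (n : nat) (u v : 'cV[R]_n) : R :=
  (u^T *m v) ord0 ord0.

(* Total function; it is the gradient at points where f is differentiable. *)
Definition grad (R : realType) (n : nat) (f : 'cV[R]_n -> R) (x : 'cV[R]_n) :
    'cV[R]_n :=
  \col_(i < n) 'D_(delta_mx i ord0) f x.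

Definition C1 (R : realType) (n : nat) (f : 'cV[R]_n -> R) : Prop :=
  (forall x, differentiable f x) /\ continuous (grad f).

Definition locally_lipschitz (R : realType) (V W : normedModType R)
    (g : V -> W) : Prop :=
  forall x : V, exists2 U : set V, nbhs x U & [lipschitz g y | y in U].

Definition continuous_selection (R : realType) (n m : nat)
    (f : 'cV[R]_n -> R) (fs : 'I_m -> 'cV[R]_n -> R) : Prop :=
  continuous f /\ forall x, exists i, f x = fs i x.

(* The set $\Omega$. *)
Definition nondiff (R : realType) (n : nat) (f : 'cV[R]_n -> R) :
    set 'cV[R]_n :=
  [set x | ~ differentiable f x].

Definition Ie (R : realType) (n m : nat)
    (f : 'cV[R]_n -> R) (fs : 'I_m -> 'cV[R]_n -> R) (x : 'cV[R]_n) :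
    set 'I_m :=
  [set i | closure (interior [set y | f y = fs i y]) x].

(* Meaningful for x outside nondiff f. *)
Definition Ig (R : realType) (n m : nat)
    (f : 'cV[R]_n -> R) (fs : 'I_m -> 'cV[R]_n -> R) (x : 'cV[R]_n) :
    set 'I_m :=
  [set i | Ie f fs x i /\ grad f x = grad (fs i) x].

Definition conv_hull (R : realType) (n : nat) (A : set 'cV[R]_n) :
    set 'cV[R]_n :=
  smallest (fun C : set 'cV[R]_n => convex_set C) A.

(* For locally Lipschitz f (in particular for continuous selections of C1
   functions): the convex hull of the limits of gradients along sequences of
   points of differentiability converging to x. *)
Definition clarke_subdiff (R : realType) (n : nat) (f : 'cV[R]_n -> R)
    (x : 'cV[R]_n) : set 'cV[R]_n :=
  conv_hull [set xi : 'cV[R]_n | exists u : nat -> 'cV[R]_n,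
    [/\ forall j, ~ nondiff f (u j),
        u j @[j --> \oo] --> x
      & grad f (u j) @[j --> \oo] --> xi]].

Definition critical_point (R : realType) (n : nat) (f : 'cV[R]_n -> R)
    (x : 'cV[R]_n) : Prop :=
  clarke_subdiff f x 0.

Definition affinely_independent (R : realType) (n m : nat)
    (v : 'I_m -> 'cV[R]_n) : Prop :=
  forall c : 'I_m -> R,
    \sum_(i < m) c i = 0 -> \sum_(i < m) c i *: v i = 0 -> forall i, c i = 0.

Definition unique_global_min (R : realType) (n : nat) (f : 'cV[R]_n -> R)
    (x : 'cV[R]_n) : Prop :=
  forall y, y != x -> f x < f y.

Definition spd (R : realType) (n : nat) (H : 'M[R]_n) : Prop :=
  H^T = H /\ forall v : 'cV[R]_n, v != 0 -> 0 < dotv v (H *m v).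

(* s lists the eigenvalues of H, with multiplicity, in nondecreasing order. *)
Definition eigenvalues_sorted (R : realType) (n : nat) (H : 'M[R]_n)
    (s : n.-tuple R) : Prop :=
  sorted <=%R s /\ char_poly H = \prod_(a <- s) ('X - a%:P).

Definition wolfe (R : realType) (n : nat) (f : 'cV[R]_n -> R) (c1 c2 : R)
    (x p : 'cV[R]_n) (t : R) : Prop :=
  [/\ ~ nondiff f (x + t *: p),
      f (x + t *: p) <= f x + c1 * t * dotv (grad f x) p
    & dotv (grad f (x + t *: p)) p >= c2 * dotv (grad f x) p].

(* One iteration, from (x, H) to (x', H'), in which the method does not stop. *)
Definition qn_iteration (R : realType) (n : nat) (f : 'cV[R]_n -> R)
    (c1 c2 : R) (x : 'cV[R]_n) (H : 'M[R]_n) (x' : 'cV[R]_n) (H' : 'M[R]_n) :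
    Prop :=
  let p := - (H *m grad f x) in
  [/\ grad f x != 0,
      exists t : R, [/\ 0 < t, wolfe f c1 c2 x p t & x' = x + t *: p],
      ~ nondiff f x',
      spd H'
    & H' *m (grad f x' - grad f x) = x' - x].

(* (x k)_k and (H k)_k are generated by the method, which does not stop in the
   first K iterations.  Only x k and H k with k <= K are constrained: since the
   method may stop later, further iterates need not exist. *)
Definition qn_run (R : realType) (n : nat) (f : 'cV[R]_n -> R) (c1 c2 : R)
    (K : nat) (x : nat -> 'cV[R]_n) (H : nat -> 'M[R]_n) : Prop :=
  [/\ ~ nondiff f (x 0%N),
      spd (H 0%N)
    & forall k, (k < K)%N ->
        qn_iteration f c1 c2 (x k) (H k) (x k.+1) (H k.+1)].

(* Main.v *)
Require Import Defs.
From HB Require Import structures.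
From mathcomp Require Import all_boot all_order all_algebra.
From mathcomp Require Import all_classical all_reals all_analysis.
From mathcomp Require Import ring lra.

Set Implicit Arguments.
Unset Strict Implicit.
Unset Printing Implicit Defensive.

Import Order.TTheory GRing.Theory Num.Theory.
Import numFieldNormedType.Exports.

Local Open Scope classical_set_scope.
Local Open Scope ring_scope.

(* Along an ultrafilter on the sequence index l, every bounded quantity
   converges and every finitely valued one is eventually constant.  Fix such an
   ultrafilter.  By descent and boundedness of the sublevel set, x^{l,k} -> xs
   for each k, and grad f (x^{l,k}) -> v_{j(k)}, where v_i = grad f_i (xs) and
   j(k) is the eventual value of an index in I_g (x^{l,k}).  The claim reduces to
   injectivity of j on {0, ..., m-1}.  Suppose j is injective on {0, ..., k} but
   j(k+1) = j(a) with a <= k, and let M be the limit of H_{l,k}.  Since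
   H_{l,k} y^{l,q} -> 0 for q < k, M takes the same value on
   v_{j(0)}, ..., v_{j(k)}; the curvature condition then gives
   (1 - c2) v_{j(k)}^T M v_{j(k)} <= 0, so M kills v_{j(0)}, ..., v_{j(k)}.
   Fewer than m of the v_i are linearly independent (the only linear relation,
   up to scaling, is the positive one), so M has corank at least k+1 and its
   characteristic polynomial is O(t^{k+1}) at -t.  But the characteristic
   polynomial of H_{l,k} at -t is at least t^k sigma_L^{n-k} in absolute value. *)

(** * Convergence along ultrafilters *)

Lemma ultra_fmap (T U : Type) (u : T -> U) (F : set_system T) :
  UltraFilter F -> UltraFilter (u @ F).
Proof.
move=> UF; have PF : ProperFilter F by exact: ultra_proper.
apply: Build_UltraFilter => G PG sFG; rewrite eqEsubset; split => // A GA.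
have [//|nA] := in_ultra_setVsetC (u @^-1` A) UF.
have : G (A `&` ~` A) by apply: filterI => //; exact: sFG.
by rewrite setICr => /filter_ex [].
Qed.

Lemma bounded_ultra_cvg (R : realType) (T : Type) (F : set_system T)
    (u : T -> R) (B : R) :
  UltraFilter F -> (\forall l \near F, `|u l| <= B) ->
  exists a : R, u @ F --> a.
Proof.
move=> UF uB; have UG := ultra_fmap u UF.
have := @segment_compact R (- B) B; rewrite compact_ultra.
move=> /(_ (u @ F) UG) [|a [_ ua]]; last by exists a.
by near=> l; rewrite /= in_itv /= -ler_norml; near: l.
Unshelve. all: by end_near. Qed.

Lemma cvg_mx (R : realType) (T : Type) (F : set_system T) (m n : nat)
    (u : T -> 'M[R]_(m, n)) (M : 'M[R]_(m, n)) :
  Filter F -> (forall i j, u l i j @[l --> F] --> M i j) -> u @ F --> M.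
Proof.
move=> FF uM; apply/cvg_mx_entourageP => A entA.
apply: (@filter_forall _ _
  (fun i (N : 'M[R]_(m, n)) => forall j, (M i j, N i j) \in A)) => i.
apply: (@filter_forall _ _
  (fun j (N : 'M[R]_(m, n)) => (M i j, N i j) \in A)) => j.
have /cvg_entourageP/(_ A entA) := uM i j.
rewrite !nearE /fmap /=; apply: filterS => l /= ?; exact: mem_set.
Qed.

(** * Active gradients of a continuous selection *)

(** A finite form of the Baire argument: if [U] is not contained in [E a], then the nonempty open
    set [U] minus [E a] is covered by the remaining sets, and induction applies to it. *)
Lemma finite_closed_cover (T : topologicalType) (I : eqType) (s : seq I)
    (E : I -> set T) (U : set T) :
  (forall i, closed (E i)) -> open U -> U !=set0 ->
  (forall x, U x -> exists2 i, i \in s & E i x) ->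
  exists2 i, i \in s & U `&` interior (E i) !=set0.
Proof.
move=> cE; elim: s U => [|a s IHs] U oU [x Ux] cov.
  by have [i] := cov _ Ux.
have [UEa|] := pselect (U `<=` E a).
  exists a; first by rewrite mem_head.
  exists x; split=> //.
  by apply: filterS UEa _; exact: open_nbhs_nbhs.
move=> /existsNP[z /not_implyP[Uz nEaz]].
have [i si [w [[Uw _] Ew]]] : exists2 i, i \in s &
    (U `&` ~` E a) `&` interior (E i) !=set0.
  apply: IHs; first by apply: openI => //; rewrite openC.
    by exists z.
  move=> w [Uw nEw]; have [i] := cov _ Uw.
  by rewrite in_cons => /orP[/eqP->//|]; exists i.
by exists i; [rewrite in_cons si orbT|exists w].
Qed.

(** A linear subspace containing a ball around [x] contains [x + t *: d] for some [t != 0], hence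
    also [d]. *)
Lemma submod_interior (R : realType) (V : normedModType R) (S : set V) (x : V) :
  (forall (a : R) u v, S u -> S v -> S (a *: u + v)) ->
  interior S x -> S = setT.
Proof.
move=> linS Sx; apply/seteqP; split => // d _.
have Sx0 : S x by exact: nbhs_singleton Sx.
have cvx : (fun t : R => x + t *: d) @ (0 : R) --> x.
  rewrite -[X in _ --> X]addr0 -(scale0r d); apply: cvgD; first exact: cvg_cst.
  by apply: cvgZr_tmp; exact: cvg_id.
have [t /= Stx t0] : exists2 t : R, S (x + t *: d) & t != 0.
  have : \forall t \near (0 : R)^', S (x + t *: d) /\ t != 0.
    rewrite near_withinE.
    have Fq : \forall t \near (0 : R), S (x + t *: d) by exact: cvx _ Sx.
    by near=> t => ?; split => //; near: t.
  by move=> /filter_ex[t []]; exists t.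
have S0 : S 0 by rewrite -(subrr x) addrC -scaleN1r; exact: linS.
have -> : d = t^-1 *: (- 1 *: x + (x + t *: d)) + 0.
  by rewrite scaleN1r addKr scalerA mulVf// scale1r addr0.
exact/linS/S0/linS.
Unshelve. all: by end_near. Qed.

Lemma closed_closure_interior (V : topologicalType) (A : set V) :
  closed A -> closure (interior A) `<=` A.
Proof.
move=> /closure_id cA; rewrite [X in _ `<=` X]cA.
by apply: closureS; exact: interior_subset.
Qed.

Lemma closed_eq_fun (R : realType) (V : topologicalType) (f g : V -> R) :
  continuous f -> continuous g -> closed [set y | f y = g y].
Proof.
move=> cf cg.
have -> : [set y | f y = g y] = (fun y => f y - g y) @^-1` [set 0].
  apply/seteqP; split => y /=; first by move->; rewrite subrr.
  by move=> /eqP; rewrite subr_eq0 => /eqP.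
apply: closed_comp; last exact: closed_eq.
by move=> y _; apply: continuousB; [exact: cf|exact: cg].
Qed.

(** Otherwise some open set near [x] would be covered by the coincidence sets of indices that are
    not essentially active at [x]. One of these sets would have interior points there, although near
    [x] such interiors are empty. *)
Lemma selection_near (R : realType) (V : topologicalType) (m : nat) (f : V -> R)
    (fs : 'I_m -> V -> R) (x : V) :
  continuous f -> (forall i, continuous (fs i)) ->
  (forall y, exists i, f y = fs i y) ->
  \forall y \near x, exists2 i,
    closure (interior [set z | f z = fs i z]) x & f y = fs i y.
Proof.
move=> cf cfs sf; pose E i := [set y | f y = fs i y].
pose Ie i := closure (interior (E i)) x.
have cE i : closed (E i) by exact: closed_eq_fun.
(* [W] collects the points that avoid the interior of [E i] for every [i] not essentially active at
   [x]. *)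
pose W y := forall i, ~ Ie i -> ~ interior (E i) y.
have nW : nbhs x W.
  apply: filter_forall => i.
  have [xi|nxi] := pselect (Ie i); first exact: nearW.
  have [B Bx nB] : exists2 B, nbhs x B & ~ (interior (E i) `&` B !=set0).
    apply: contrapT => h; apply: nxi => B Bx; apply: contrapT => nB.
    by apply: h; exists B.
  by apply: filterS Bx => y By _ Ey; apply: nB; exists y.
have : nbhs x (interior W) by exact/nbhs_interior.
apply: filterS => y Wy; apply: contrapT => nIe.
(* On the open set [U] no essentially active function agrees with [f], so the inactive ones must
   cover it. *)
pose U := interior (fun w => W w /\ forall i, Ie i -> ~ E i w).
have Uy : U y.
  apply: filterI => //; apply: filter_forall => i.
  have [xi|nxi] := pselect (Ie i); last exact: nearW.
  have : nbhs y (~` E i).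
    apply: open_nbhs_nbhs; split; first by rewrite openC.
    by move=> Ey; apply: nIe; exists i.
  by apply: filterS.
have [i _ [w [Uw Ew]]] : exists2 i, i \in enum 'I_m &
    U `&` interior (E i) !=set0.
  apply: finite_closed_cover => //; first exact: open_interior.
    by exists y.
  by move=> w _; have [i fi] := sf w; exists i; rewrite ?mem_enum.
have [Ww nEw] := interior_subset Uw.
have [xi|nxi] := pselect (Ie i); last exact: Ww nxi Ew.
exact: nEw xi (interior_subset Ew).
Qed.

(** For each direction some admissible [fs i] has the same derivative as [f], with [i] depending on
    the direction. The kernels of the differentials of [f - fs i] are thus finitely many closed
    subspaces covering the whole space, so one of them has interior points and is the whole
    space. *)
Lemma selection_diff (R : realType) (V : normedModType R) (m : nat) (f : V -> R)
    (fs : 'I_m -> V -> R) (x : V) (P : 'I_m -> Prop) :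
  differentiable f x -> (forall i, differentiable (fs i) x) ->
  (forall i, P i -> f x = fs i x) ->
  (\forall y \near x, exists2 i, P i & f y = fs i y) ->
  exists2 i, P i & forall d, 'D_d f x = 'D_d (fs i) x.
Proof.
move=> df dfs Pf nf.
have dg i : differentiable (f - fs i) x by exact: differentiableB.
have Dg i d : 'D_d (f - fs i) x = 'D_d f x - 'D_d (fs i) x.
  by rewrite deriveB//; exact: diff_derivable.
(* If every admissible derivative of [f - fs i] along [d] were nonzero, then [f] would differ from
   all these [fs i] at [t *: d + x] for small [t != 0]. *)
have along d : exists2 i, P i & 'D_d (f - fs i) x = 0.
  apply: contrapT => nD.
  have nz : \forall t \near (0 : R)^',
      forall i, P i -> f (t *: d + x) <> fs i (t *: d + x).
    apply: filter_forall => i.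
    have [Pi|nPi] := pselect (P i); last exact: nearW.
    have Dn0 : 'D_d (f - fs i) x != 0.
      by apply/eqP => D0; apply: nD; exists i.
    pose q (t : R) := t^-1 *: (((f - fs i) \o shift x) (t *: d) - (f - fs i) x).
    have cq : q @ (0 : R)^' --> 'D_d (f - fs i) x by exact: diff_derivable.
    have nq : \forall t \near (0 : R)^', q t != 0 by exact: cvgr_neq0 cq Dn0.
    apply: filterS nq => t /eqP qn _ e; apply: qn.
    by rewrite /q /= /shift /= !fctE e// (Pf i Pi) !subrr scaler0.
  have nf' : \forall t \near (0 : R)^', exists2 i, P i &
      f (t *: d + x) = fs i (t *: d + x).
    have cvx : (fun t : R => t *: d + x) @ (0 : R) --> x.
      rewrite -[X in _ --> X]add0r -(scale0r d).
      by apply: cvgD; [apply: cvgZr_tmp; exact: cvg_id|exact: cvg_cst].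
    by apply: cvg_within; exact: cvx _ nf.
  have [t [nt [i Pi fi]]] := filter_ex (filterI nz nf').
  exact: nt i Pi fi.
pose S i := [set d | 'D_d (f - fs i) x = 0].
have SE i : S i = 'd (f - fs i) x @^-1` [set 0].
  by apply/seteqP; split => d; rewrite /S /= deriveE.
have cS i : closed (S i).
  rewrite SE; apply: closed_comp; last exact: closed_eq.
  by move=> d _; exact: diff_continuous.
have [i Pi [d [_ Sd]]] : exists2 i, i \in [seq i <- enum 'I_m | `[< P i >]] &
    setT `&` interior (S i) !=set0.
  apply: finite_closed_cover => //; first exact: openT.
    by exists 0.
  move=> d _; have [i Pi Di] := along d; exists i; rewrite // mem_filter.
  by rewrite mem_enum andbT; apply/asboolP.
exists i; first by move: Pi; rewrite mem_filter => /andP[/asboolP].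
move=> e; apply/eqP; rewrite -subr_eq0 -Dg; apply/eqP.
have ST : S i = setT.
  apply: submod_interior Sd => a u v; rewrite SE /= => u0 v0.
  by rewrite linearP u0 v0 scaler0 addr0.
by have : S i e by rewrite ST.
Qed.

Lemma Ig_nonempty (R : realType) (n m : nat) (f : 'cV[R]_n -> R)
    (fs : 'I_m -> 'cV[R]_n -> R) (x : 'cV[R]_n) :
  continuous_selection f fs -> (forall i y, differentiable (fs i) y) ->
  differentiable f x -> exists i, Ig f fs x i.
Proof.
move=> sel dfs df.
have cfs i : continuous (fs i).
  by move=> y; exact: differentiable_continuous (dfs i y).
have [cf sf] := sel.
have [i Pi Di] : exists2 i, Ie f fs x i & forall d, 'D_d f x = 'D_d (fs i) x.
  apply: selection_diff => //; last exact: selection_near cf cfs sf.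
  by move=> i; apply: closed_closure_interior; exact: closed_eq_fun.
exists i; split => //; apply/colP => j; rewrite !mxE; exact: Di.
Qed.

(** * Semidefinite matrices, characteristic polynomials and eigenvalues *)

Section DotProduct.
Variables (R : realType) (n : nat).
Implicit Types (u v w : 'cV[R]_n) (a : R) (H : 'M[R]_n).

Lemma dotvE u v : dotv u v = \sum_i u i ord0 * v i ord0.
Proof. by rewrite /dotv mxE; apply: eq_bigr => i _; rewrite mxE. Qed.

Lemma dotvDl u v w : dotv (u + v) w = dotv u w + dotv v w.
Proof. by rewrite /dotv linearD mulmxDl mxE. Qed.

Lemma dotvDr u v w : dotv w (u + v) = dotv w u + dotv w v.
Proof. by rewrite /dotv mulmxDr mxE. Qed.

Lemma dotvZl a u v : dotv (a *: u) v = a * dotv u v.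
Proof. by rewrite /dotv linearZ -scalemxAl mxE. Qed.

Lemma dotvZr a u v : dotv u (a *: v) = a * dotv u v.
Proof. by rewrite /dotv -scalemxAr mxE. Qed.

Lemma dotvNr u v : dotv u (- v) = - dotv u v.
Proof. by rewrite -scaleN1r dotvZr mulN1r. Qed.

Lemma dotvC u v : dotv u v = dotv v u.
Proof. by rewrite !dotvE; apply: eq_bigr => i _; rewrite mulrC. Qed.

Lemma dotv_delta i v : dotv (delta_mx i ord0) v = v i ord0.
Proof. by rewrite /dotv trmx_delta -rowE mxE. Qed.

Lemma dotvv_gt0 v : v != 0 -> 0 < dotv v v.
Proof.
move=> v0; rewrite dotvE lt0r sumr_ge0 ?andbT;
  last by move=> i _; exact: sqr_ge0.
apply: contra v0; rewrite psumr_eq0; last by move=> i _; exact: sqr_ge0.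
move/allP => h; apply/eqP/colP => i; rewrite mxE; apply/eqP.
by have := h i (mem_index_enum _); rewrite mulf_eq0 orbb.
Qed.

Lemma dotv_sym H u v : H^T = H -> dotv u (H *m v) = dotv v (H *m u).
Proof.
by move=> sH; rewrite dotvC /dotv trmx_mul sH mulmxA.
Qed.

(** The closed counterpart of [spd]: this is what survives in a limit of the matrices [H l]. *)
Definition psd H := H^T = H /\ forall v, 0 <= dotv v (H *m v).

Lemma spd_psd H : spd H -> psd H.
Proof.
move=> [sH pH]; split => // v; have [->|v0] := eqVneq v 0; last exact/ltW/pH.
by rewrite mulmx0 dotvE big1// => i _; rewrite mxE mul0r.
Qed.

Lemma psd_cauchy_schwarz H u v : psd H ->
  dotv u (H *m v) ^+ 2 <= dotv u (H *m u) * dotv v (H *m v).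
Proof.
move=> [sH pH].
have Q (s t : R) : 0 <= s ^+ 2 * dotv u (H *m u)
    + 2 * s * t * dotv u (H *m v) + t ^+ 2 * dotv v (H *m v).
  have := pH (s *: u + t *: v).
  rewrite mulmxDr -!scalemxAr !(dotvDl, dotvDr, dotvZl, dotvZr) (dotv_sym v u sH).
  by congr (0 <= _); ring.
move: (dotv u (H *m u)) (dotv u (H *m v)) (dotv v (H *m v)) (pH v) Q.
move=> a b c c0 Q; move: c0; rewrite le_eqVlt => /predU1P[c0|c0].
  have [->|b0] := eqVneq b 0; first by rewrite -c0 expr0n mulr0.
  (* For [c = 0] and [s = 1] the form is affine in [t] with slope [2 * b]; this [t] makes it equal
     to -1. *)
  have := Q 1 (- (a + 1) / (2 * b)); rewrite -c0.
  have -> : 1 ^+ 2 * a + 2 * 1 * (- (a + 1) / (2 * b)) * b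
      + (- (a + 1) / (2 * b)) ^+ 2 * 0 = - 1 by field.
  by rewrite lerNr oppr0 ler10.
(* The form at [s = c], [t = - b] equals [c * (a * c - b ^+ 2)]. *)
rewrite -(ler_pM2l c0) -subr_ge0; have := Q c (- b).
by congr (0 <= _); ring.
Qed.

(** Cauchy-Schwarz against each basis vector shows that every entry of [H *m v] vanishes. *)
Lemma psd_kernel H v : psd H -> dotv v (H *m v) = 0 -> H *m v = 0.
Proof.
move=> pH v0; apply/colP => i; rewrite [RHS]mxE -dotv_delta; apply/eqP.
rewrite -sqrf_eq0 eq_le sqr_ge0 andbT.
by have := psd_cauchy_schwarz (delta_mx i ord0) v pH; rewrite v0 mulr0.
Qed.

(** Cauchy-Schwarz bounds the square of [H i j] by [H i i * H j j], and each diagonal entry is at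
    most the trace. *)
Lemma psd_entry_bound H i j : psd H -> `|H i j| <= \tr H.
Proof.
move=> pH.
have dE k l : dotv (delta_mx k ord0) (H *m delta_mx l ord0) = H k l.
  by rewrite dotv_delta -colE mxE.
have d0 k : 0 <= H k k by rewrite -dE; exact: pH.2.
have dtr k : H k k <= \tr H.
  by rewrite /mxtrace (bigD1 k)//= lerDl sumr_ge0.
have := psd_cauchy_schwarz (delta_mx i ord0) (delta_mx j ord0) pH.
rewrite !dE => h; have tr0 := le_trans (d0 i) (dtr i).
rewrite -(@ler_pXn2r _ 2) ?nnegrE// real_normK ?num_real//.
by apply: le_trans h _; rewrite expr2 ler_pM.
Qed.

Lemma spd_eigenvalue_gt0 H a : spd H -> root (char_poly H) a -> 0 < a.
Proof.
move=> [sH pH]; rewrite -eigenvalue_root_char => /eigenvalueP[v vH v0].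
have vT0 : v^T != 0 by rewrite trmx_eq0.
have := pH _ vT0; have -> : H *m v^T = a *: v^T.
  by rewrite -{1}sH -trmx_mul vH linearZ.
by rewrite dotvZr pmulr_lgt0// dotvv_gt0.
Qed.

Lemma char_poly_horner H a : (char_poly H).[a] = \det (a%:M - H).
Proof.
rewrite -horner_evalE -det_map_mx; congr (\det _); apply/matrixP => i j.
rewrite !mxE -[LHS]/(('X *+ (i == j) - (H i j)%:P).[a]).
by rewrite hornerD hornerN hornerC hornerMn hornerX.
Qed.

(** Multiplying [char_poly_mx H] on the left by the inverse of [col_ebase H] leaves [n - \rank H]
    rows in which only the term with ['X] survives; each of them contributes one factor ['X] to the
    determinant. *)
Lemma char_poly_dvd_corank H : ('X^(n - \rank H) %| char_poly H)%R.
Proof.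
set r := \rank H; set C := col_ebase H.
have uC : C \in unitmx by exact: col_ebase_unit.
(* [B] is the transformed matrix with the factor ['X] removed from the rows of index at least [r];
   [d] records these factors. *)
pose B : 'M[{poly R}]_n := \matrix_(i, j)
  if (i < r)%N then ((map_mx polyC (invmx C)) *m char_poly_mx H) i j
  else (invmx C i j)%:P.
pose d : 'rV[{poly R}]_n := \row_i (if (i < r)%N then 1 else 'X).
have E : map_mx polyC (invmx C) *m char_poly_mx H = diag_mx d *m B.
  rewrite mul_diag_mx; apply/matrixP => i j.
  rewrite [RHS]mxE ![d _ _]mxE ![B _ _]mxE.
  case: ifPn => [_|]; first by rewrite mul1r.
  rewrite -leqNgt => ri.
  rewrite /char_poly_mx mulmxBr mul_mx_scalar -map_mxM.
  have -> : invmx C *m H = pid_mx r *m row_ebase H.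
    by rewrite -[H in LHS]mulmx_ebase -mulmxA mulKmx.
  have : (pid_mx r *m row_ebase H) i j = 0.
    by rewrite mxE big1// => k _; rewrite mxE ltnNge ri andbF mul0r.
  by move: (pid_mx r *m _) => N N0; rewrite !mxE N0 subr0.
(* The factor [\det C] cancels the determinant of [invmx C]. *)
have := congr1 (fun A => (\det (C : 'M[R]_n))%:P * \det A) E.
rewrite !det_mulmx det_diag det_map_mx mulrA -polyCM -det_mulmx mulmxV//.
rewrite det1 mul1r.
rewrite -/(char_poly H) => ->.
apply: dvdp_mull; apply: dvdp_mulr.
have -> : \prod_i d 0 i = \prod_(i < n | (r <= i)%N) 'X.
  rewrite (bigID (fun i : 'I_n => (i < r)%N)) /= big1 ?mul1r.
    by apply: eq_big => [i|i ir]; [rewrite -leqNgt|rewrite mxE (negbTE ir)].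
  by move=> i ir; rewrite mxE ir.
rewrite -(prodr_const_nat r n ('X : {poly R})) big_geq_mkord /=.
exact: dvdpp.
Qed.

Lemma char_poly_corank_bound H :
  exists C : R, forall a, `|a| <= 1 ->
    `|(char_poly H).[a]| <= C * `|a| ^+ (n - \rank H).
Proof.
have /dvdpP[q qE] := char_poly_dvd_corank H.
have [C qC] := poly_disk_bound q 1.
exists C => a a1; rewrite qE hornerM hornerXn normrM normrX.
by rewrite ler_wpM2r ?exprn_ge0 ?qC.
Qed.

Section Spectrum.
Variables (H : 'M[R]_n) (s : n.-tuple R).
Hypotheses (spdH : spd H) (eigH : eigenvalues_sorted H s).

Lemma spd_eigenvalues_gt0 a : a \in s -> 0 < a.
Proof.
case: eigH => _ cH; rewrite -root_prod_XsubC -cH; exact: spd_eigenvalue_gt0.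
Qed.

Lemma mxtrace_eigenvalues : \tr H = \sum_(a <- s) a.
Proof.
(* The case [n = 0] is separate: there the coefficient of index [n.-1] is the leading one and not
   minus the trace. *)
have [n0|n0] := posnP n.
  have no (i : 'I_n) : False.
    by move: (leq_ltn_trans (leq0n i) (ltn_ord i)); rewrite n0.
  by rewrite /mxtrace big_tuple !big1// => i; case: (no i).
apply: oppr_inj; rewrite -char_poly_trace// eigH.2.
by rewrite -coefPn_prod_XsubC size_tuple -?lt0n.
Qed.

(** The trace is the sum of the eigenvalues. As [k] lies in ['I_n], at least one eigenvalue is
    bounded by [b], and sortedness extends the bound to the smaller ones. *)
Lemma spd_entry_eigenvalue_bound (b : R) (k : 'I_n) i j :
  (forall l : 'I_n, (k <= l)%N -> tnth s l <= b) -> `|H i j| <= n%:R * b.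
Proof.
move=> sb; apply: le_trans (psd_entry_bound i j (spd_psd spdH)) _.
rewrite mxtrace_eigenvalues big_tuple.
have le_b l : tnth s l <= b.
  have [|lk] := leqP k l; first exact: sb.
  apply: le_trans (sb k (leqnn k)); have x0 := tnth s k.
  rewrite !(tnth_nth x0).
  apply: (sorted_leq_nth le_trans lexx x0 eigH.1); rewrite ?inE ?size_tuple//.
  exact: ltnW.
apply: le_trans (ler_sum _ (fun l _ => le_b l)) _.
by rewrite sumr_const card_ord mulr_natl.
Qed.

(** Up to sign the value at [- t] is the product of all [t + tnth s l]; each factor is at least [t]
    by positivity, and at least [b] for the indices from [k] on. *)
Lemma spd_char_poly_ge (b t : R) (k : nat) :
  0 < t -> 0 < b -> (k <= n)%N ->
  (forall l : 'I_n, (k <= l)%N -> b <= tnth s l) ->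
  t ^+ k * b ^+ (n - k) <= `|(char_poly H).[- t]|.
Proof.
move=> t0 b0 kn bs; rewrite eigH.2 horner_prod normr_prod big_tuple.
have -> : t ^+ k * b ^+ (n - k) = \prod_(l < n) (if (l < k)%N then t else b).
  rewrite (bigID (fun l : 'I_n => (l < k)%N)) /=; congr (_ * _).
    rewrite (eq_bigr (fun=> t)); last by move=> l ->.
    by rewrite -(big_ord_widen n (fun=> t) kn) prodr_const card_ord.
  rewrite (eq_big (fun l : 'I_n => (k <= l)%N) (fun=> b)).
  - by rewrite -(prodr_const_nat k n b) big_geq_mkord.
  - by move=> l; rewrite -leqNgt.
  - by move=> l /negbTE ->.
apply: ler_prod => l _; have s0 := spd_eigenvalues_gt0 (mem_tnth l s).
rewrite !hornerE -opprD normrN gtr0_norm ?addr_gt0//.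
case: ltnP => [_|kl]; first by rewrite ltW// lerDl ltW.
by rewrite ltW// ler_wpDl ?bs// ltW.
Qed.

End Spectrum.

End DotProduct.

(** * Continuity of matrix operations and compactness of bounded matrices *)

Section MatrixLimits.
Context {R : realType} {T : Type} {F : set_system T} {FF : Filter F}.

Lemma cvg_entry (m n : nat) (u : T -> 'M[R]_(m, n)) (M : 'M[R]_(m, n)) i j :
  u @ F --> M -> u l i j @[l --> F] --> M i j.
Proof.
move=> uM; apply: (cvg_comp u (fun N : 'M[R]_(m, n) => N i j) uM).
exact: coord_continuous.
Qed.

Lemma cvg_mulmx (m n p : nat) (u : T -> 'M[R]_(m, n)) (v : T -> 'M[R]_(n, p))
    (M : 'M[R]_(m, n)) (N : 'M[R]_(n, p)) :
  u @ F --> M -> v @ F --> N -> u l *m v l @[l --> F] --> M *m N.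
Proof.
move=> uM vN; apply: cvg_mx => i j; rewrite mxE.
under eq_cvg do rewrite mxE.
apply: cvg_big => [|k _]; first exact: add_continuous.
by apply: cvgM; exact: cvg_entry.
Qed.

Lemma cvg_dotv (n : nat) (u v : T -> 'cV[R]_n) (a b : 'cV[R]_n) :
  u @ F --> a -> v @ F --> b -> dotv (u l) (v l) @[l --> F] --> dotv a b.
Proof.
move=> ua vb; rewrite dotvE; under eq_cvg do rewrite dotvE.
apply: cvg_big => [|k _]; first exact: add_continuous.
by apply: cvgM; exact: cvg_entry.
Qed.

Lemma cvg_det (n : nat) (u : T -> 'M[R]_n) (M : 'M[R]_n) :
  u @ F --> M -> \det (u l) @[l --> F] --> \det M.
Proof.
move=> uM; apply: cvg_big => [|s _]; first exact: add_continuous.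
apply: cvgM; first exact: cvg_cst.
apply: cvg_big => [|k _]; first exact: mul_continuous.
exact: cvg_entry.
Qed.

Lemma cvg_char_poly_horner (n : nat) (u : T -> 'M[R]_n) (M : 'M[R]_n) (a : R) :
  u @ F --> M -> (char_poly (u l)).[a] @[l --> F] --> (char_poly M).[a].
Proof.
move=> uM; rewrite char_poly_horner; under eq_cvg do rewrite char_poly_horner.
by apply: cvg_det; apply: cvgB => //; exact: cvg_cst.
Qed.

End MatrixLimits.

Lemma bounded_ultra_cvg_mx (R : realType) (T : Type) (F : set_system T)
    (m n : nat) (u : T -> 'M[R]_(m, n)) (B : R) :
  UltraFilter F -> (\forall l \near F, forall i j, `|u l i j| <= B) ->
  exists M : 'M[R]_(m, n), u @ F --> M.
Proof.
move=> UF uB; have FF : Filter F by exact: ultra_proper.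
have /choice[g gP] (ij : 'I_m * 'I_n) :
    exists a : R, u l ij.1 ij.2 @[l --> F] --> a.
  by apply: (bounded_ultra_cvg (B := B)) => //; apply: filterS uB.
exists (\matrix_(i, j) g (i, j)); apply: cvg_mx => i j.
by rewrite mxE; exact: gP (i, j).
Qed.

(** * Limits of positive definite matrices *)

Section SpdLimit.
Variables (R : realType) (n : nat) (F : set_system nat).
Context {PF : ProperFilter F}.
Variables (H : nat -> 'M[R]_n) (M : 'M[R]_n).
Hypotheses (HM : H @ F --> M) (spdH : forall l, spd (H l)).

Lemma spd_cvg_psd : psd M.
Proof.
split=> [|v].
  apply/matrixP => i j; rewrite mxE.
  have := cvg_entry (i := i) (j := j) HM.
  under eq_cvg do rewrite -(spdH _).1 mxE.
  by move=> HM'; apply: (cvg_unique (@norm_hausdorff _ R) (cvg_entry HM) HM').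
have Hv : H l *m v @[l --> F] --> M *m v.
  by apply: cvg_mulmx => //; exact: cvg_cst.
have cv : dotv v (H l *m v) @[l --> F] --> dotv v (M *m v).
  by apply: cvg_dotv => //; exact: cvg_cst.
apply: (ler_cvg_to (f := fun=> 0) (cvg_cst _) cv); apply: nearW => l.
exact: (spd_psd (spdH l)).2.
Qed.

(** The lower bound of [spd_char_poly_ge] passes to the limit. A corank above [k] would bound the
    same value by a constant times [t ^+ k.+1], which is too small for small [t]. *)
Lemma spd_cvg_corank (s : nat -> n.-tuple R) (b : R) (k : nat) :
  0 < b -> (k <= n)%N ->
  (forall l, eigenvalues_sorted (H l) (s l)) ->
  (forall l (i : 'I_n), (k <= i)%N -> b <= tnth (s l) i) ->
  (n - \rank M <= k)%N.
Proof.
move=> b0 kn eigH sb; rewrite leqNgt; apply/negP => kr.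
have [C CP] := char_poly_corank_bound M.
have lo (t : R) : 0 < t -> t ^+ k * b ^+ (n - k) <= `|(char_poly M).[- t]|.
  move=> t0.
  have cv : `|(char_poly (H l)).[- t]| @[l --> F] --> `|(char_poly M).[- t]|.
    by apply: cvg_norm; exact: cvg_char_poly_horner.
  apply: (ler_cvg_to (f := fun=> t ^+ k * b ^+ (n - k)) (cvg_cst _) cv).
  apply: nearW => l.
  have := spd_char_poly_ge (spdH l) (eigH l) t0 b0 kn (sb l); exact.
set e := b ^+ (n - k); have e0 : 0 < e by rewrite exprn_gt0.
have C0 : 0 <= C.
  have := CP 1; rewrite normr1 lexx expr1n mulr1 => /(_ isT).
  exact: le_trans.
have bd (t : R) : 0 < t -> t <= 1 -> e <= C * t.
  move=> t0 t1; have := le_trans (lo t t0) (CP (- t) _).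
  rewrite normrN gtr0_norm// => /(_ t1); rewrite -/e.
  have : t ^+ (n - \rank M) <= t ^+ k.+1 by apply: ler_wiXn2l => //; exact: ltW.
  rewrite exprS => h1 h2.
  rewrite -(@ler_pM2l _ (t ^+ k)) ?exprn_gt0//.
  apply: le_trans h2 _; rewrite mulrCA ler_wpM2l// mulrC//.
have eC : 0 < e + C by rewrite ltr_wpDr.
(* This choice satisfies [t <= 1] and makes [C * t < e], also when [C = 0]. *)
have := bd (e / (e + C)); rewrite divr_gt0// ler_pdivrMr// mul1r lerDl C0.
move=> /(_ isT isT); rewrite mulrA ler_pdivlMr// mulrC ler_pM2r// gerDr.
by rewrite leNgt e0.
Qed.

End SpdLimit.

(** * Reduction of eventual statements to ultrafilters *)

(** If [P] failed to be in [F], the restriction of [F] to the complement of [P] would be proper and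
    extend to an ultrafilter containing both [P] and its complement. *)
Lemma ultra_near (T : Type) (F : set_system T) (P : set T) : Filter F ->
  (forall G, UltraFilter G -> F `<=` G -> G P) -> F P.
Proof.
move=> FF h; apply: contrapT => nFP.
have PF : ProperFilter (within (~` P) F).
  apply: Build_ProperFilter; rewrite /within /= => FP.
  by apply: nFP; apply: filterS FP => t; apply: contrapT.
have [G [UG FG]] := ultraFilterLemma PF.
have PG : ProperFilter G by exact: ultra_proper.
have GP : G P by apply: h => // A FA; apply: FG; apply: filterS FA => t At _.
have GnP : G (~` P) by apply: FG; apply: nearW.
by have [t []] := filter_ex (filterI GP GnP).
Qed.

Lemma ultra_finite (T : Type) (F : set_system T) (I : finType) (u : T -> I) :
  UltraFilter F -> exists i, \forall l \near F, u l = i.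
Proof.
move=> UF; have PF : ProperFilter F by exact: ultra_proper.
apply: contrapT => h.
have : \forall l \near F, forall i, u l <> i.
  apply: filter_forall => i.
  have [ui|//] := in_ultra_setVsetC [set l | u l = i] UF.
  by case: h; exists i.
by case/filter_ex => l /(_ (u l)).
Qed.

(** * Linear relations in an affinely independent family *)

Section AffineIndependence.
Variables (R : realType) (n m : nat) (v : 'I_m -> 'cV[R]_n).
Hypothesis v_aff : affinely_independent v.
Variable alpha : 'I_m -> R.
Hypotheses (alpha_gt0 : forall i, 0 < alpha i)
  (alpha_v : \sum_(i < m) alpha i *: v i = 0).

(** Subtracting the multiple [a] of [alpha] that makes the coefficients sum to zero leaves an affine
    relation, so [c] is [a] times [alpha]. A zero coefficient then forces [a = 0], since [alpha] is
    positive. *)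
Lemma proper_subfamily_free (c : 'I_m -> R) (i0 : 'I_m) :
  c i0 = 0 -> \sum_(i < m) c i *: v i = 0 -> forall i, c i = 0.
Proof.
move=> c0 cv; set s := \sum_i alpha i.
have s0 : s != 0.
  by rewrite gt_eqF// /s (bigD1 i0)//= ltr_pwDl// sumr_ge0// => i _; exact: ltW.
pose a := (\sum_i c i) / s.
have h : forall i, c i - a * alpha i = 0.
  apply: v_aff.
    by rewrite sumrB -mulr_sumr -/s divfK// subrr.
  under eq_bigr do rewrite scalerBl -scalerA.
  by rewrite sumrB cv -scaler_sumr alpha_v scaler0 subr0.
have a0 : a = 0.
  have /eqP := h i0; rewrite c0 sub0r oppr_eq0 mulf_eq0.
  by rewrite [alpha _ == 0]gt_eqF// orbF => /eqP.
by move=> i; have := h i; rewrite a0 mul0r subr0.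
Qed.

Lemma proper_subfamily_row_free (k : nat) (phi : 'I_k -> 'I_m) :
  injective phi -> (k < m)%N -> row_free (\matrix_(q < k) (v (phi q))^T).
Proof.
move=> phiI km; apply: inj_row_free => w /(congr1 trmx).
rewrite trmx0 mulmx_sum_row linear_sum /= => w0.
have [i0 i0phi] : exists i0, i0 \notin codom phi.
  apply/existsP; rewrite -negb_forall; apply/negP => /forallP h.
  have : #|codom phi| = #|'I_m| by apply: eq_card => i; rewrite h.
  by rewrite (card_codom phiI) !card_ord => kE; rewrite kE ltnn in km.
(* The coefficients are transported along [phi] and vanish off its image, in particular at [i0]. *)
pose c i := \sum_(q | phi q == i) w ord0 q.
have c0 : forall i, c i = 0.
  apply: (@proper_subfamily_free c i0).
    rewrite /c big_pred0// => q; apply: contraNF i0phi => /eqP <-.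
    exact: codom_f.
  rewrite -[RHS]w0 (partition_big phi predT)//=; apply: eq_bigr => i _.
  rewrite scaler_suml; apply: eq_bigr => q /eqP <-.
  by rewrite linearZ rowK /= trmxK.
apply/rowP => q; rewrite mxE -[RHS](c0 (phi q)) /c (big_pred1 q)// => r.
by rewrite /= (inj_eq phiI).
Qed.

Lemma proper_subfamily_size (k : nat) (phi : 'I_k -> 'I_m) :
  injective phi -> (k < m)%N -> (k <= n)%N.
Proof.
move=> phiI km; have /eqP <- := proper_subfamily_row_free phiI km.
exact: rank_leq_col.
Qed.

(** The [k] independent vectors lie in the kernel; symmetry of [M] turns this into a statement about
    the row kernel [kermx]. *)
Lemma proper_subfamily_corank (k : nat) (phi : 'I_k -> 'I_m) (M : 'M[R]_n) :
  injective phi -> (k < m)%N -> M^T = M -> (forall q, M *m v (phi q) = 0) ->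
  (k <= n - \rank M)%N.
Proof.
move=> phiI km sM Mv; have /eqP <- := proper_subfamily_row_free phiI km.
rewrite -mxrank_ker; apply: mxrankS; apply/sub_kermxP/row_matrixP => q.
by rewrite row_mul rowK row0 -sM -trmx_mul Mv trmx0.
Qed.

End AffineIndependence.

(** * Descent and convergence of the iterates *)

Lemma entry_le_norm (R : realType) (m n : nat) (M : 'M[R]_(m, n)) i j :
  `|M i j| <= `|M|.
Proof.
rewrite [leRHS]/Num.norm /= mx_normrE.
exact: (le_bigmax _ (fun ij => `|M ij.1 ij.2|) (i, j)).
Qed.

(** The direction is minus a positive definite matrix times the gradient, so the sufficient decrease
    condition never lets [f] grow. *)
Lemma qn_descent (R : realType) (n : nat) (f : 'cV[R]_n -> R) (c1 c2 : R)
    (K : nat) (x : nat -> 'cV[R]_n) (H : nat -> 'M[R]_n) :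
  0 < c1 -> qn_run f c1 c2 K x H -> forall k, (k <= K)%N ->
  [/\ differentiable f (x k), spd (H k) & f (x k) <= f (x 0%N)].
Proof.
move=> c10 [d0 spd0 step]; elim=> [|k IHk] kK.
  by split => //; exact: contrapT.
have [_ spdk le0] := IHk (ltnW kK).
have [_ [t [t0 [_ dec _] xE]] ndf spdk1 _] := step k kK.
split=> //; first exact: contrapT.
apply: le_trans le0; rewrite xE; apply: le_trans dec _.
rewrite gerDl dotvNr mulrN oppr_le0 mulr_ge0//; first by rewrite mulr_ge0// ltW.
exact: (spd_psd spdk).2.
Qed.

(** Since [f xs < f z], the points [u l] eventually lie in the bounded sublevel set and converge
    along [F]; the limit has value at most [f xs], so it is the unique minimizer. *)
Lemma sublevel_cvg (R : realType) (n : nat) (f : 'cV[R]_n -> R)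
    (xs z : 'cV[R]_n) (F : set_system nat) (u : nat -> 'cV[R]_n) (b : nat -> R) :
  UltraFilter F -> continuous f -> unique_global_min f xs -> z != xs ->
  bounded_set [set x | f x <= f z] -> b @ F --> f xs ->
  (forall l, f (u l) <= b l) -> u @ F --> xs.
Proof.
move=> UF cf fmin zxs bnd bF ub.
have PF : ProperFilter F by exact: ultra_proper.
have [B fB] : exists B, forall x, f x <= f z -> `|x| <= B.
  have [B [_ fB]] := bnd; exists (B + 1) => x fx.
  by apply: (fB (B + 1)) => //; rewrite ltrDl.
have bz : \forall l \near F, b l < f z by exact: cvgr_lt bF _ (fmin z zxs).
have [a ua] : exists a : 'cV[R]_n, u @ F --> a.
  apply: (bounded_ultra_cvg_mx (B := B)) => //.
  apply: filterS bz => l bl i j; apply: le_trans (entry_le_norm _ _ _) _.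
  by apply: fB; apply: le_trans (ub l) _; exact: ltW.
have fua : f (u l) @[l --> F] --> f a by apply: cvg_comp ua _; exact: cf.
have fa : f a <= f xs by apply: (ler_cvg_to fua bF); exact: nearW.
by have [<-//|/fmin] := eqVneq a xs; rewrite ltNge fa.
Qed.

(** * Distinctness of the limiting active indices, and the covering of all indices *)

Lemma ultra_qn_injective (R : realType) (n m : nat) (v : 'I_m -> 'cV[R]_n)
    (alpha : 'I_m -> R) (F : set_system nat) (j : nat -> 'I_m)
    (g : nat -> nat -> 'cV[R]_n) (H : nat -> nat -> 'M[R]_n)
    (lam : nat -> nat -> n.-tuple R) (c2 sigL sigU : R) :
  UltraFilter F -> affinely_independent v ->
  (forall i, 0 < alpha i) -> \sum_(i < m) alpha i *: v i = 0 ->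
  c2 < 1 -> 0 < sigL ->
  (forall k, (k < m)%N -> g l k @[l --> F] --> v (j k)) ->
  (forall l k, (k < m)%N -> spd (H l k)) ->
  (forall l k, (k < m)%N -> eigenvalues_sorted (H l k) (lam l k)) ->
  (forall l k (i : 'I_n), (k.+1 < m)%N -> (k <= i)%N ->
     sigL <= tnth (lam l k) i <= sigU) ->
  (forall k q, (k.+1 < m)%N -> (q < k)%N ->
     H l k *m (g l q.+1 - g l q) @[l --> F] --> (0 : 'cV[R]_n)) ->
  (forall l k, (k.+1 < m)%N ->
     c2 * dotv (g l k) (- (H l k *m g l k))
     <= dotv (g l k.+1) (- (H l k *m g l k))) ->
  forall k, (k < m)%N -> {in [pred q | (q <= k)%N] &, injective j}.
Proof.
move=> UF v_aff alpha0 alphav c21 sigL0 gv spdH eigH lamb Hg wolfeg.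
have PF : ProperFilter F by exact: ultra_proper.
elim=> [_ a b|k IHk k1m]; first by rewrite !inE !leqn0 => /eqP-> /eqP->.
have {IHk} jI := IHk (ltnW k1m).
pose phi (q : 'I_k.+1) := j q.
have phiI : injective phi.
  by move=> a b e; apply/val_inj/jI => //; rewrite inE -ltnS ltn_ord.
(* This gives [k < n], so that [k] is a valid eigenvalue index and the upper bound [sigU] on the
   eigenvalues from [k] on is not vacuous. *)
have kn := proper_subfamily_size v_aff alpha0 alphav phiI k1m.
have km : (k < m)%N by exact: ltnW.
have [M HM] : exists M : 'M[R]_n, H l k @[l --> F] --> M.
  apply: (bounded_ultra_cvg_mx (B := n%:R * sigU)) => //.
  apply: nearW => l a b.
  apply: (spd_entry_eigenvalue_bound (spdH l k km) (eigH l k km)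
    (k := Ordinal kn)).
  by move=> i ki; have /andP[] := lamb l k i k1m ki.
have psdM : psd M by apply: spd_cvg_psd HM _ => l; exact: spdH.
have corM : (n - \rank M <= k)%N.
  apply: (spd_cvg_corank HM _ sigL0 (ltnW kn)) => [l|l|l i ki].
  - exact: spdH.
  - exact: eigH.
  - by have /andP[] := lamb l k i k1m ki.
(* The secant limits say that [M] kills consecutive differences; induction chains these
   equalities. *)
have Mv q : (q <= k)%N -> M *m v (j q) = M *m v (j 0%N).
  elim: q => // q IHq qk; rewrite -(IHq (ltnW qk)).
  apply/eqP; rewrite -subr_eq0 -mulmxBr; apply/eqP/colP => i.
  have c1 : (H l k *m (g l q.+1 - g l q)) i ord0 @[l --> F] -->
      (M *m (v (j q.+1) - v (j q))) i ord0.
    apply: cvg_entry; apply: cvg_mulmx => //; apply: cvgB; apply: gv.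
      exact: leq_ltn_trans qk km.
    exact: ltn_trans qk km.
  have c0 : (H l k *m (g l q.+1 - g l q)) i ord0 @[l --> F] -->
      (0 : 'cV[R]_n) i ord0 by apply: cvg_entry; exact: Hg.
  exact: (cvg_unique (@norm_hausdorff _ R) c1 c0).
have jnew a : (a <= k)%N -> j k.+1 != j a.
  move=> ak; apply/eqP => ja.
  set A := dotv (v (j k)) (M *m v (j k)).
  have A0 : 0 <= A by exact: psdM.2.
  have p_cvg : - (H l k *m g l k) @[l --> F] --> - (M *m v (j k)).
    by apply: cvgN; apply: cvg_mulmx => //; exact: gv.
  have : c2 * dotv (v (j k)) (- (M *m v (j k))) <=
      dotv (v (j k.+1)) (- (M *m v (j k))).
    apply: (@ler_cvg_to _ F _ _
      (fun l => c2 * dotv (g l k) (- (H l k *m g l k)))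
      (fun l => dotv (g l k.+1) (- (H l k *m g l k)))).
    - by apply: cvgMr; apply: cvg_dotv => //; exact: gv.
    - by apply: cvg_dotv => //; exact: gv.
    - by apply: nearW => l; exact: wolfeg.
  (* By symmetry and [Mv], both sides of the limiting curvature condition are multiples of [A],
     leaving [A <= c2 * A]; with [c2 < 1] this forces [A = 0]. *)
  rewrite ja !dotvNr (dotv_sym _ _ psdM.1) (Mv a ak) -(Mv k (leqnn k)) -/A.
  rewrite mulrN lerN2 => Ac2.
  have A00 : A = 0 by apply/eqP; rewrite eq_le A0 andbT; nra.
  have Mk : M *m v (j k) = 0 by exact: psd_kernel.
  have Mphi q : M *m v (phi q) = 0.
    by rewrite /phi (Mv q (leq_ord q)) -(Mv k (leqnn k)).
  (* The kernel would have dimension at least [k.+1], contradicting [corM]. *)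
  have := proper_subfamily_corank v_aff alpha0 alphav phiI k1m psdM.1 Mphi.
  by rewrite ltnNge corM.
move=> a b; rewrite !inE leq_eqVlt => /predU1P[->|ak];
  rewrite leq_eqVlt => /predU1P[->|bk] //.
- by move=> e; have := jnew b bk; rewrite e eqxx.
- by move=> e; have := jnew a ak; rewrite e eqxx.
- by apply: jI; rewrite inE.
Qed.

Theorem theorem2 (R : realType) (n m : nat)
  (f : 'cV[R]_n -> R) (fs : 'I_m -> 'cV[R]_n -> R)
  (fsel : continuous_selection f fs)
  (fsC1 : forall i, C1 (fs i))
  (fsLip : forall i, locally_lipschitz (grad (fs i)))
  (xs : 'cV[R]_n)
  (xs_crit : critical_point f xs)
  (xs_pos : exists alpha : 'I_m -> R, (forall i, 0 < alpha i) /\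
     \sum_(i < m) alpha i *: grad (fs i) xs = 0)
  (xs_aff : affinely_independent (fun i => grad (fs i) xs))
  (xs_min : unique_global_min f xs)
  (xs_level : exists2 z : 'cV[R]_n, z != xs &
     bounded_set [set x | f x <= f z])
  (c1 c2 : R)
  (c1_gt0 : 0 < c1) (c1_lt_c2 : c1 < c2) (c2_lt1 : c2 < 1)
  (x : nat -> nat -> 'cV[R]_n) (H : nat -> nat -> 'M[R]_n)
  (y : nat -> nat -> 'cV[R]_n)
  (lam : nat -> nat -> n.-tuple R)
  (x0_cvg : x l 0%N @[l --> \oo] --> xs)
  (run : forall l, qn_run f c1 c2 m.-1 (x l) (H l))
  (y_def : forall l k, (k.+1 < m)%N ->
     y l k = grad f (x l k.+1) - grad f (x l k))
  (lam_def : forall l k, (k < m)%N -> eigenvalues_sorted (H l k) (lam l k))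
  (sigL sigU : R) (sigL_gt0 : 0 < sigL) (sigU_gt0 : 0 < sigU)
  (* The 1-based eigenvalue index j in {k+1, ..., n} corresponds to the ordinal j - 1 >= k. *)
  (lam_bounds : forall l k (j : 'I_n), (k.+1 < m)%N -> (k <= j)%N ->
     sigL <= tnth (lam l k) j <= sigU)
  (Hy_cvg : forall k' k, (0 < k')%N -> (k'.+1 < m)%N -> (k < k')%N ->
     H l k' *m y l k @[l --> \oo] --> (0 : 'cV[R]_n)) :
  exists2 N : nat, (0 < N)%N &
    forall l, (N < l)%N -> \bigcup_(k < m) Ig f fs (x l k) = [set: 'I_m].
Proof.
suff : \forall l \near \oo, \bigcup_(k < m) Ig f fs (x l k) = [set: 'I_m].
  by move=> [N _ NP]; exists N.+1 => // l Nl; apply: NP; exact: ltnW (ltnW Nl).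
apply: ultra_near => G UG subG; have PG : ProperFilter G by exact: ultra_proper.
have [cf sf] := fsel; have [i0 _] := sf xs.
have m0 : (0 < m)%N by exact: leq_ltn_trans (leq0n i0) (ltn_ord i0).
have dfs i y0 : differentiable (fs i) y0 by exact: (fsC1 i).1.
have runP l k : (k < m)%N ->
    [/\ differentiable f (x l k), spd (H l k) & f (x l k) <= f (x l 0%N)].
  by move=> km; apply: (qn_descent c1_gt0 (run l)); rewrite -ltnS prednK.
(* The iterates are constrained only for indices below [m]; elsewhere [idx] takes the default value
   [i0]. *)
have /choice[idx idxP] (lk : nat * nat) :
    exists i, (lk.2 < m)%N -> Ig f fs (x lk.1 lk.2) i.
  have [km|_] := ltnP lk.2 m; last by exists i0.
  have [df _ _] := runP lk.1 _ km.
  by have [i Ii] := Ig_nonempty fsel dfs df; exists i.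
have /choice[j jP] k : exists i, \forall l \near G, idx (l, k) = i.
  exact: (ultra_finite (fun l => idx (l, k))).
have fx0 : f (x l 0%N) @[l --> G] --> f xs.
  have x0G : x l 0%N @[l --> G] --> xs.
    by move=> A A0; apply: subG; exact: x0_cvg.
  exact: (cvg_comp (fun l => x l 0%N) f x0G (cf xs)).
have xk_cvg k : (k < m)%N -> x l k @[l --> G] --> xs.
  have [z zxs bz] := xs_level.
  move=> km; apply: (sublevel_cvg UG cf xs_min zxs bz fx0) => l.
  by have [] := runP l k km.
pose v i := grad (fs i) xs.
(* Along [G] the index in [Ig] is eventually [j k], so the gradient of [f] agrees with that of the
   single function [fs (j k)], whose gradient is continuous. *)
have gv k : (k < m)%N -> grad f (x l k) @[l --> G] --> v (j k).
  move=> km; have gfs : grad (fs (j k)) (x l k) @[l --> G] --> v (j k).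
    exact: (cvg_comp (x^~ k) (grad (fs (j k))) (xk_cvg k km)
      ((fsC1 (j k)).2 xs)).
  apply: cvg_trans gfs; apply: near_eq_cvg.
  by apply: filterS (jP k) => l <-; have [_ ->] := idxP (l, k) km.
have [alpha [alpha0 alphav]] := xs_pos.
have spdH l k : (k < m)%N -> spd (H l k) by move=> km; have [] := runP l k km.
have stepP l k : (k.+1 < m)%N ->
    qn_iteration f c1 c2 (x l k) (H l k) (x l k.+1) (H l k.+1).
  by move=> km; have [_ _] := run l; apply; rewrite -ltnS prednK.
have jI : forall k, (k < m)%N -> {in [pred q | (q <= k)%N] &, injective j}.
  apply: (ultra_qn_injective (g := fun l k => grad f (x l k)) UG xs_aff alpha0
    alphav c2_lt1 sigL_gt0 gv spdH lam_def lam_bounds).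
    move=> k q km qk; have q1m := leq_ltn_trans qk (ltnW km).
    under eq_cvg => l do rewrite -y_def//.
    move=> A A0; apply: subG.
    exact: (Hy_cvg k q (leq_ltn_trans (leq0n q) qk) km qk).
  by move=> l k km; have [_ [t [_ [_ _ w] ->]] _ _ _] := stepP l k km.
have jmI : injective (fun k : 'I_m => j k).
  have le_pred (a : 'I_m) : val a \in [pred q | (q <= m.-1)%N].
    by rewrite inE -ltnS prednK ?ltn_ord.
  move=> a b e; apply/val_inj/(jI m.-1 _ _ _ (le_pred a) (le_pred b) e).
  by rewrite prednK.
have jall : \forall l \near G, forall k : 'I_m, idx (l, val k) = j k.
  by apply: filter_forall => k; exact: jP.
apply: filterS jall => l jl; apply/seteqP; split => // i _.
(* An injective self-map of the finite index set is onto, so each [i] is the index chosen at iterate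
   [j' i]. *)
have [j' _ j'K] := injF_bij jmI.
exists (j' i); first exact: ltn_ord.
by have := idxP (l, val (j' i)) (ltn_ord _); rewrite jl j'K.
Qed.
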